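(* In the setting described in the context, the bisection stage of the bisection search makes at most $$2+\log\left[C_0^2M_0\lambda_+^0\left(\frac{1+2C+L_2M_0\lambda_+^0+2\left(L_2+\frac1{M_0\lambda_+^0}\right)(1+\hat\sigma)\alpha_-}{(1-\hat\sigma)\alpha_+-(1+\hat\sigma)\alpha_-}\right)\right]$$ oracle calls, where $$C_0=\frac{(1+\hat\sigma)(1+2L_2\gamma_0)\left[2L'(\lambda_+^0)^2+\lambda_+^0d(x_+^0)+(\lambda_+^0)^2L_2\,d(x_+^0)^2\right]+\left[(1+2C)\gamma_0+L_2\gamma_0^2\right](1-C)(1-\hat\sigma)}{(1-C)(1-\hat\sigma)^2\alpha_-},$$ $\gamma_0=M_1\lambda_+^0\|x_+^0-\tilde x(0)\|$, and $d(x_+^0)$ denotes the distance of $x_+^0$ to $x_*$.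
   Context: Setting: $\mathcal G:\mathbb{R}^d\to\mathbb{R}^d$ is monotone and differentiable with $L_2$-Lipschitz derivative $\mathcal G'$; $\mathcal H:\mathbb{R}^d\rightrightarrows\mathbb{R}^d$ is maximal monotone and $\|w\|\le L'$ for all $x$ and $w\in\mathcal H(x)$; $\mathcal T=\mathcal G+\mathcal H$; $x_*\in\mathcal T^{-1}(0)$. For a monotone operator $\mathcal B$ and $\epsilon\ge0$, $\mathcal B^\epsilon(x)=\{v:\langle x-x',v-v'\rangle\ge-\epsilon\ \forall x',\forall v'\in\mathcal B(x')\}$. $\mathcal P$ maps each $x\in\mathbb{R}^d$ to a linear operator with $\|\mathcal P(x)-\mathcal G'(x)\|<\delta$, is $L_2$-Lipschitz in $x$, and is such that $\mathcal T_{x,\delta}:=\mathcal G_{x,\delta}+\mathcal H$ is maximal monotone, where $\mathcal G_{x,\delta}(y)=\mathcal G(x)+\mathcal P(x)(y-x)$. $(y,u,\epsilon)\in\mathrm{ANS}_{\hat\sigma,\delta}(\lambda,x)$ means $\epsilon\ge0$, $u\in(\mathcal G_{x,\delta}+\mathcal H^\epsilon)(y)$ and $\|\lambda u+y-x\|^2+2\lambda\epsilon\le\hat\sigma^2\|y-x\|^2$. One oracle call = one computation of such a triple. Constants: $0<\hat\sigma<1$, $0<C<1$, $\delta>0$, $\alpha_+>\alpha_->0$ with $\alpha_-(1+\hat\sigma)<\alpha_+(1-\hat\sigma)$. The curve $\tilde x:[0,\infty)\to\mathbb{R}^d$ satisfies, for constants $M_0,M_1>0$, $\|\tilde x(s)-\tilde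 x(t)\|\le\min\{\frac{M_0}t(s-t),M_1\|\tilde x(s)-\tilde x(0)\|\}$ for $0<t\le s$. Bisection search: the right bracketing point $\lambda_+^0>0$ satisfies $\lambda_+^0\delta=C$; with $x_+^0=\tilde x(\lambda_+^0)$ and $(y_+^0,u_+^0,\epsilon_+^0)\in\mathrm{ANS}_{\hat\sigma,\delta}(\lambda_+^0,x_+^0)$ one has $\lambda_+^0\|y_+^0-x_+^0\|>\alpha_+$ (the search is only called in this case). Bracketing stage: set $$\lambda_-^0=\frac{(1-\hat\sigma)\alpha_-\lambda_+^0}{(1+\hat\sigma)(1+2L_2\gamma_0)\lambda_+^0\|y_+^0-x_+^0\|+(1+2C)\gamma_0+L_2\gamma_0^2}$$ and compute an approximate Newton solution at $(\lambda_-^0,\tilde x(\lambda_-^0))$. Bisection stage: start with $\lambda_-=\lambda_-^0$, $\lambda_+=\lambda_+^0$; repeat: $\lambda=(\lambda_-+\lambda_+)/2$, compute $(y_\lambda,u_\lambda,\epsilon_\lambda)\in\mathrm{ANS}_{\hat\sigma,\delta}(\lambda,\tilde x(\lambda))$; stop if $\lambda\|y_\lambda-\tilde x(\lambda)\|\in[\alpha_-,\alpha_+]$; else set $\lambda_+=\lambda$ if this quantity exceeds $\alpha_+$, $\lambda_-=\lambda$ if it is below $\alpha_-$. $\log$ denotes the base-2 logarithm. *)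

(* Defs.v *)
From HB Require Import structures.
From mathcomp Require Import all_boot all_order all_algebra.
From mathcomp Require Import all_classical all_reals all_analysis.
Set Implicit Arguments.
Unset Strict Implicit.
Unset Printing Implicit Defensive.
Import Order.TTheory GRing.Theory Num.Theory.
Import numFieldNormedType.Exports.
Local Open Scope classical_set_scope.
Local Open Scope ring_scope.

(* The norm that MathComp-Analysis puts on 'rV[R]_d is the sup norm, so the
   Euclidean inner product and norm of R^d are defined here.  The library's
   'differentiable' can be used as is, the two norms being equivalent. *)
Definition dotv (R : realType) (d : nat) (u v : 'rV[R]_d) : R :=
  (u *m v^T) 0 0.

Definition enorm (R : realType) (d : nat) (u : 'rV[R]_d) : R :=
  Num.sqrt (dotv u u).

(* Linear operators of R^d are matrices acting on row vectors on the right,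
   v |-> v *m A, which is the convention of the library's 'jacobian'. *)
Definition opnorm (R : realType) (d : nat) (A : 'M[R]_d) : R :=
  sup [set enorm (v *m A) | v in [set v : 'rV[R]_d | enorm v <= 1]].

(* A point-to-set operator is a map to sets; its graph is the set of pairs
   (x, v) with B x v. *)
Definition operator (R : realType) (d : nat) := 'rV[R]_d -> set 'rV[R]_d.

Definition single_valued (R : realType) (d : nat) (G : 'rV[R]_d -> 'rV[R]_d) :
  operator R d := fun x => [set G x].

Definition operator_add (R : realType) (d : nat) (A B : operator R d) :
  operator R d := fun x => [set u + v | u in A x & v in B x].

Definition monotone_operator (R : realType) (d : nat) (B : operator R d) : Prop :=
  forall x x' v v', B x v -> B x' v' -> 0 <= dotv (x - x') (v - v').

Definition maximal_monotone (R : realType) (d : nat) (B : operator R d) : Prop :=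
  monotone_operator B /\
  forall B' : operator R d, monotone_operator B' ->
    (forall x, B x `<=` B' x) -> forall x, B' x `<=` B x.

Definition enlargement (R : realType) (d : nat) (eps : R) (B : operator R d) :
  operator R d :=
  fun x => [set v | forall x' v', B x' v' -> - eps <= dotv (x - x') (v - v')].

Definition model (R : realType) (d : nat) (G : 'rV[R]_d -> 'rV[R]_d)
    (P : 'rV[R]_d -> 'M[R]_d) (x y : 'rV[R]_d) : 'rV[R]_d :=
  G x + (y - x) *m P x.

(* The accuracy delta only enters through the hypotheses made on P. *)
Definition approx_newton_solution (R : realType) (d : nat)
    (G : 'rV[R]_d -> 'rV[R]_d) (P : 'rV[R]_d -> 'M[R]_d) (H : operator R d)
    (sigma lambda : R) (x y u : 'rV[R]_d) (eps : R) : Prop :=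
  [/\ 0 <= eps,
      operator_add (single_valued (model G P x)) (enlargement eps H) y u &
      enorm (lambda *: u + y - x) ^+ 2 + 2 * lambda * eps
        <= sigma ^+ 2 * enorm (y - x) ^+ 2].

(* [bisection_calls oracle xt am ap lm lp n]: some execution of the bisection,
   started with the bracket lm, lp, has made n oracle calls.  Executions may be
   cut short ([bisection_pending]), so a bound on n valid for all of them also
   excludes nonterminating ones.  [oracle lambda x y u eps] says that (y, u, eps)
   is an admissible answer to the call at (lambda, x); answers are arbitrary and
   may depend on the history. *)
Inductive bisection_calls (R : realType) (d : nat)
    (oracle : R -> 'rV[R]_d -> 'rV[R]_d -> 'rV[R]_d -> R -> Prop)
    (xt : R -> 'rV[R]_d) (am ap : R) : R -> R -> nat -> Prop :=
| bisection_pending (lm lp : R) :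
    bisection_calls oracle xt am ap lm lp 0
| bisection_stop (lm lp lambda : R) (y u : 'rV[R]_d) (eps : R) :
    lambda = (lm + lp) / 2 ->
    oracle lambda (xt lambda) y u eps ->
    am <= lambda * enorm (y - xt lambda) <= ap ->
    bisection_calls oracle xt am ap lm lp 1
| bisection_right (lm lp lambda : R) (y u : 'rV[R]_d) (eps : R) (n : nat) :
    lambda = (lm + lp) / 2 ->
    oracle lambda (xt lambda) y u eps ->
    ap < lambda * enorm (y - xt lambda) ->
    bisection_calls oracle xt am ap lm lambda n ->
    bisection_calls oracle xt am ap lm lp n.+1
| bisection_left (lm lp lambda : R) (y u : 'rV[R]_d) (eps : R) (n : nat) :
    lambda = (lm + lp) / 2 ->
    oracle lambda (xt lambda) y u eps ->
    lambda * enorm (y - xt lambda) < am ->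
    bisection_calls oracle xt am ap lambda lp n ->
    bisection_calls oracle xt am ap lm lp n.+1.

Definition log2 (R : realType) (x : R) : R := ln x / ln 2.

(* Main.v *)
Require Import Defs.
From HB Require Import structures.
From mathcomp Require Import all_boot all_order all_algebra.
From mathcomp Require Import all_classical all_reals all_analysis.
From mathcomp Require Import ring lra.
Set Implicit Arguments.
Unset Strict Implicit.
Unset Printing Implicit Defensive.
Import Order.TTheory GRing.Theory Num.Theory.
Import numFieldNormedType.Exports.
Local Open Scope classical_set_scope.
Local Open Scope ring_scope.

(** Write [T x] for the operator linearized at [x] plus [H], and consider, for
    each [l], the exact solution [z] of [z + l T(x) z = x] at [x = xt l], together
    with its residual [phi l = l * enorm (z - x)].  The exact solution exists by
    Minty's theorem ([resolvent_exists]).  An approximate Newton solution [y] has a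
    residual within factors [1 - sigma] and [1 + sigma] of the exact one
    ([newton_step_bounds]), so whatever answers the oracle gives, the bisection
    keeps [phi <= (1 + sigma) * am] at the left endpoint and
    [phi >= (1 - sigma) * ap] at the right one.

    These two levels are separated by a positive gap, whereas [phi] cannot grow
    fast along the curve: for a fixed base point, [enorm (z - x)] grows at most
    linearly in [l] ([resolvent_monotone]); moving the base point perturbs the
    linearized problem by an amount controlled by the Newton remainder, the
    accuracy [delta] and the Lipschitz constant of [P] ([resolvent_change_base]),
    and the curve bounds that displacement by [M0 * (m - l) / l].  Hence the length
    of a bracket is at least a constant times the gap ([resolvent_growth],
    [bracket_gap]).  Each call halves the length, so the number of calls is bounded
    by a logarithm ([bisection_calls_le]).

    Two facts make the constant explicit.  The first left endpoint is small enough
    for the left invariant to hold ([left_endpoint_residual_le]), and its ratio to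
    the right endpoint is at least [C0^-1], because the residual at the right
    endpoint is bounded through the distance to the zero [xs]
    ([resolvent_dist_zero]).

    An element of the enlargement of [H] gives one of the enlargement of [T x]
    because [P x] is monotone.  This follows from the monotonicity of [T x], as the
    range of [H] is bounded while its domain comes within bounded distance of every
    point ([model_psd]). *)

(** * The Euclidean inner product and the operator norm *)

Lemma continuous_sum (R : realType) (V : normedModType R) (T : topologicalType)
    (I : finType) (F : I -> T -> V) :
  (forall i, continuous (F i)) -> continuous (fun t => \sum_i F i t).
Proof.
move=> cF; apply: (@continuous_big V I +%R 0 xpredT) => [|i _]; last exact: cF.
exact: add_continuous.
Qed.

Section InnerProduct.
Variables (R : realType) (d : nat).
Implicit Types (u v w : 'rV[R]_d) (a : R).

Lemma dotvE u v : dotv u v = \sum_j u 0 j * v 0 j.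
Proof. by rewrite /dotv mxE; apply: eq_bigr => j _; rewrite mxE. Qed.

Lemma dotvC u v : dotv u v = dotv v u.
Proof. by rewrite !dotvE; apply: eq_bigr => j _; rewrite mulrC. Qed.

Lemma dotvDl u v w : dotv (u + v) w = dotv u w + dotv v w.
Proof. by rewrite /dotv mulmxDl mxE. Qed.

Lemma dotvDr u v w : dotv w (u + v) = dotv w u + dotv w v.
Proof. by rewrite dotvC dotvDl !(dotvC w). Qed.

Lemma dotvZl a u v : dotv (a *: u) v = a * dotv u v.
Proof. by rewrite /dotv -scalemxAl mxE. Qed.

Lemma dotvZr a u v : dotv u (a *: v) = a * dotv u v.
Proof. by rewrite dotvC dotvZl dotvC. Qed.

Lemma dotvNl u v : dotv (- u) v = - dotv u v.
Proof. by rewrite -scaleN1r dotvZl mulN1r. Qed.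

Lemma dotvNr u v : dotv u (- v) = - dotv u v.
Proof. by rewrite dotvC dotvNl dotvC. Qed.

Lemma dotv0l u : dotv 0 u = 0.
Proof. by rewrite -(scale0r u) dotvZl mul0r. Qed.

Definition dotv_lin := (dotvDl, dotvDr, dotvNl, dotvNr, dotvZl, dotvZr).

Lemma dotv_ge0 u : 0 <= dotv u u.
Proof. by rewrite dotvE; apply: sumr_ge0 => j _; rewrite -expr2 sqr_ge0. Qed.

Lemma dotv_eq0 u : dotv u u = 0 -> u = 0.
Proof.
rewrite dotvE => /eqP; rewrite psumr_eq0; last first.
  by move=> j _; rewrite -expr2 sqr_ge0.
move/allP => h; apply/rowP => j; rewrite mxE.
by have := h j (mem_index_enum _); rewrite -expr2 sqrf_eq0 => /eqP.
Qed.

Lemma dotv_suml (I : finType) (F : I -> 'rV[R]_d) w :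
  dotv (\sum_i F i) w = \sum_i dotv (F i) w.
Proof.
apply: (big_morph (fun u => dotv u w)); last exact: dotv0l.
by move=> u v; rewrite dotvDl.
Qed.

Lemma dotv_sumr (I : finType) (F : I -> 'rV[R]_d) w :
  dotv w (\sum_i F i) = \sum_i dotv w (F i).
Proof. by rewrite dotvC dotv_suml; apply: eq_bigr => i _; rewrite dotvC. Qed.

Lemma enorm_ge0 u : 0 <= enorm u.
Proof. exact: sqrtr_ge0. Qed.

Lemma enorm_sqr u : enorm u ^+ 2 = dotv u u.
Proof. by rewrite sqr_sqrtr// dotv_ge0. Qed.

Lemma enorm_eq0 u : enorm u = 0 -> u = 0.
Proof. by move=> h; apply: dotv_eq0; rewrite -enorm_sqr h expr0n. Qed.

Lemma le_enorm a u : 0 <= a -> dotv u u <= a ^+ 2 -> enorm u <= a.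
Proof.
move=> a0 h; rewrite -(ler_pXn2r (n := 2))// ?nnegrE ?enorm_ge0//.
by rewrite enorm_sqr.
Qed.

Lemma enorm_dotv_le u v : dotv u u <= dotv v v -> enorm u <= enorm v.
Proof. by rewrite -(enorm_sqr v) => /le_enorm; apply; rewrite enorm_ge0. Qed.

Lemma enormN u : enorm (- u) = enorm u.
Proof. by rewrite /enorm dotvNl dotvNr opprK. Qed.

Lemma enormC u v : enorm (u - v) = enorm (v - u).
Proof. by rewrite -enormN opprB. Qed.

Lemma enormZ a u : 0 <= a -> enorm (a *: u) = a * enorm u.
Proof.
move=> a0; rewrite /enorm dotvZl dotvZr mulrA sqrtrM ?mulr_ge0//.
by rewrite -expr2 sqrtr_sqr ger0_norm.
Qed.

Lemma cauchy_schwarz u v : dotv u v <= enorm u * enorm v.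
Proof.
have [/enorm_eq0->|v0] := eqVneq (enorm v) 0.
  by rewrite dotvC dotv0l mulr_ge0// enorm_ge0.
have v_gt0 : 0 < enorm v by rewrite lt_neqAle eq_sym v0 enorm_ge0.
(* equality holds exactly when this vector vanishes *)
have := dotv_ge0 (enorm v *: u - enorm u *: v).
rewrite !dotv_lin (dotvC v u) -!enorm_sqr => h.
have [/enorm_eq0->|u0] := eqVneq (enorm u) 0.
  by rewrite dotv0l mulr_ge0// enorm_ge0.
have uv_gt0 : 0 < enorm u * enorm v.
  by rewrite mulr_gt0// lt_neqAle eq_sym u0 enorm_ge0.
rewrite -(ler_pM2l uv_gt0); nra.
Qed.

Lemma cauchy_schwarzN u v : - (enorm u * enorm v) <= dotv u v.
Proof. by have := cauchy_schwarz (- u) v; rewrite dotvNl enormN; lra. Qed.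

Lemma enormD u v : enorm (u + v) <= enorm u + enorm v.
Proof.
apply: le_enorm; first by rewrite addr_ge0 ?enorm_ge0.
rewrite !dotv_lin (dotvC v u) -!enorm_sqr.
have := cauchy_schwarz u v; lra.
Qed.

Lemma enormB u v : enorm (u - v) <= enorm u + enorm v.
Proof. by rewrite -(enormN v) enormD. Qed.

(** The Frobenius norm is such a bound; its finiteness makes the supremum that
    defines [opnorm] a genuine upper bound. *)
Lemma enorm_mulmx_bounded (A : 'M[R]_d) :
  exists2 K, 0 <= K & forall v, enorm (v *m A) <= K * enorm v.
Proof.
exists (Num.sqrt (\sum_j enorm (row j A^T) ^+ 2)); first exact: sqrtr_ge0.
move=> v; apply: le_enorm; first by rewrite mulr_ge0 ?sqrtr_ge0 ?enorm_ge0.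
rewrite exprMn sqr_sqrtr; last by apply: sumr_ge0 => j _; rewrite sqr_ge0.
rewrite mulr_suml dotvE; apply: ler_sum => j _.
have -> : (v *m A) 0 j = dotv v (row j A^T).
  by rewrite dotvE mxE; apply: eq_bigr => k _; rewrite !mxE.
have := cauchy_schwarz v (row j A^T).
have := cauchy_schwarzN v (row j A^T).
by have := enorm_ge0 v; have := enorm_ge0 (row j A^T); nra.
Qed.

Lemma opnorm_has_sup (A : 'M[R]_d) :
  has_sup [set enorm (v *m A) | v in [set v : 'rV[R]_d | enorm v <= 1]].
Proof.
have [K K0 hK] := enorm_mulmx_bounded A.
split; first by exists (enorm (0 *m A)), 0 => //=; rewrite /enorm dotv0l sqrtr0.
exists K => _ [w /= w1 <-]; apply: (le_trans (hK w)).
by rewrite -{2}[K]mulr1 ler_wpM2l.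
Qed.

Lemma enorm_mulmx_le (A : 'M[R]_d) v :
  enorm (v *m A) <= opnorm A * enorm v.
Proof.
have [K K0 hK] := enorm_mulmx_bounded A.
have [v0|v0] := eqVneq (enorm v) 0.
  by have := hK v; rewrite v0 !mulr0.
have v_gt0 : 0 < enorm v by rewrite lt_neqAle eq_sym v0 enorm_ge0.
rewrite -ler_pdivrMr// mulrC -enormZ ?invr_ge0 ?enorm_ge0// scalemxAl.
apply: sup_upper_bound; first exact: opnorm_has_sup.
exists ((enorm v)^-1 *: v) => //=.
by rewrite enormZ ?invr_ge0 ?enorm_ge0// mulVf.
Qed.

Lemma opnorm_ge0 (A : 'M[R]_d) : 0 <= opnorm A.
Proof.
apply: sup_upper_bound; first exact: opnorm_has_sup.
by exists 0; rewrite /= ?mul0mx /enorm dotv0l sqrtr0.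
Qed.

Lemma continuous_dotv (T : topologicalType) (f g : T -> 'rV[R]_d) :
  continuous f -> continuous g -> continuous (fun t => dotv (f t) (g t)).
Proof.
move=> cf cg.
have coord (h : T -> 'rV[R]_d) j : continuous h -> continuous (fun t => h t 0 j).
  move=> ch t; apply: (cvg_comp h (fun M : 'rV[R]_d => M 0 j)); first exact: ch.
  exact: coord_continuous.
rewrite (_ : (fun t => _) = fun t => \sum_j f t 0 j * g t 0 j); last first.
  by apply/funext => t; rewrite dotvE.
by apply: continuous_sum => j t; apply: cvgM; exact: coord.
Qed.

(** The library's norm on row vectors is the sup norm; this comparison turns
    Euclidean bounds into boundedness for the topology. *)
Lemma normr_le_enorm u : `|u| <= enorm u.
Proof.
rewrite [leLHS]/Num.Def.normr /= mx_normrE; apply: bigmax_le.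
  exact: enorm_ge0.
move=> [i j] _ /=; rewrite (ord1 i) -sqrtr_sqr ler_wsqrtr//.
rewrite dotvE (bigD1 j)//= -expr2 lerDl; apply: sumr_ge0 => k _.
by rewrite -expr2 sqr_ge0.
Qed.

End InnerProduct.

(** * Extension of a finite monotone relation by one point *)

(** First-order optimality condition along a segment. *)
Lemma le0_of_small_steps (R : realType) (A B : R) :
  (forall t, 0 < t -> t <= 1 -> t * A <= t ^+ 2 * B) -> A <= 0.
Proof.
move=> h; rewrite leNgt; apply/negP => A0.
have B0 : 0 < B by have := h 1 ltr01 (lexx _); rewrite !(mul1r, expr1n); lra.
have t0 : 0 < A / (A + B) by rewrite divr_gt0// addr_gt0.
have t1 : A / (A + B) <= 1 by rewrite ler_pdivrMr ?addr_gt0// mul1r; lra.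
have := h _ t0 t1; rewrite expr2 -mulrA ler_pM2l// mulrAC.
by rewrite ler_pdivlMr ?addr_gt0//; nra.
Qed.

(** Finitely many balls having [y i] and [w i] as antipodal points have a common
    point as soon as the pairs are antimonotone.  The common point is found by
    convex duality: minimizing over [z] the largest of the numbers
    [dotv (z - y i) (z - w i)] is a minimax problem, and maximizing its dual, the
    concave quadratic [dual], over the simplex needs nothing but compactness.
    First-order optimality of a maximizer [l] says that the corresponding convex
    combination of the midpoints has value at most [dual l], and antimonotonicity
    says that [dual] is nonpositive. *)
Section FiniteMinty.
Variables (R : realType) (d n : nat) (y w : 'I_n.+1 -> 'rV[R]_d).

Let simplex : set 'rV[R]_n.+1 :=
  [set l | (forall i, 0 <= l 0 i) /\ \sum_i l 0 i = 1].

Let comb (x : 'I_n.+1 -> 'rV[R]_d) (l : 'rV[R]_n.+1) : 'rV[R]_d :=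
  \sum_i l 0 i *: x i.

Let mid i : 'rV[R]_d := 2^-1 *: (y i + w i).

Let dual (l : 'rV[R]_n.+1) : R :=
  \sum_i l 0 i * dotv (y i) (w i) - dotv (comb mid l) (comb mid l).

Let coordc i : continuous (fun l : 'rV[R]_n.+1 => l 0 i).
Proof. exact: coord_continuous. Qed.

Lemma simplex_compact : compact simplex.
Proof.
apply: bounded_closed_compact.
  exists 1; split; first exact: num_real.
  move=> M M1 l [l0 l1]; rewrite /= [leLHS]/Num.Def.normr /= mx_normrE.
  apply: bigmax_le => [|[i j] _ /=]; first by rewrite ltW// (lt_trans ltr01).
  rewrite (ord1 i) ger0_norm// (le_trans _ (ltW M1))// -l1 (bigD1 j)//= lerDl.
  by apply: sumr_ge0.
have -> : simplex = (\bigcap_i [set l | 0 <= l 0 i])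
    `&` [set l | \sum_i l 0 i = 1].
  apply/seteqP; split => l /= [h1 h2]; split => // i; last exact: h1 i I.
  by move=> _; exact: h1.
apply: closedI.
  apply: closed_bigI => i _.
  apply: (@preimage_closed _ _ (fun l : 'rV[R]_n.+1 => l 0 i) [set x | 0 <= x]).
    by move=> l _; exact: coordc.
  exact: closed_ge.
apply: (@preimage_closed _ _ (fun l : 'rV[R]_n.+1 => \sum_i l 0 i) [set x | x = 1]).
  by move=> l _; apply: continuous_sum => i; exact: coordc.
exact: closed_eq.
Qed.

Let continuous_comb x : continuous (comb x).
Proof.
apply: continuous_sum => i l.
exact: (@cvgZr_tmp R _ _ (nbhs l) _ _ _ (x i) (@coordc i l)).
Qed.

Lemma continuous_dual : continuous dual.
Proof.
have c1 : continuous (fun l : 'rV[R]_n.+1 => \sum_i l 0 i * dotv (y i) (w i)).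
  by apply: continuous_sum => i l; exact: (cvgMr_tmp (@coordc i l)).
have c2 := continuous_dotv (@continuous_comb mid) (@continuous_comb mid).
by move=> l; exact: (cvgB (c1 l) (c2 l)).
Qed.

Lemma dual_max : exists2 l, simplex l & forall l', simplex l' -> dual l' <= dual l.
Proof.
have ne : simplex !=set0.
  exists (delta_mx 0 ord0); split => [i|]; first by rewrite mxE ler0n.
  rewrite (bigD1 ord0)//= mxE eqxx big1 ?addr0// => i i0.
  by rewrite mxE (negbTE i0) andbF.
have [l lS lmax] := EVT_max_rV ne simplex_compact
  (continuous_subspaceT continuous_dual).
by exists l; [exact: set_mem|move=> l' l'S; apply: lmax; exact: mem_set].
Qed.

Hypothesis yw : forall i j, dotv (y i - y j) (w i - w j) <= 0.

(** The average of the numbers [dotv (y i - y j) (w i - w j)] with weights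
    [l i * l j] is twice the covariance of [y] and [w], which bounds [dual l]. *)
Lemma dual_le0 l : simplex l -> dual l <= 0.
Proof.
move=> [l0 l1].
have cb x v : dotv (comb x l) v = \sum_i l 0 i * dotv (x i) v.
  by rewrite dotv_suml; apply: eq_bigr => i _; rewrite dotvZl.
have cb' x v : dotv v (comb x l) = \sum_i l 0 i * dotv v (x i).
  by rewrite dotv_sumr; apply: eq_bigr => i _; rewrite dotvZr.
have h : \sum_i l 0 i * \sum_j l 0 j * dotv (y i - y j) (w i - w j) <= 0.
  apply: sumr_le0 => i _; apply: mulr_ge0_le0 => //.
  by apply: sumr_le0 => j _; apply: mulr_ge0_le0.
set b := \sum_i l 0 i * dotv (y i) (w i).
have inner i : \sum_j l 0 j * dotv (y i - y j) (w i - w j) =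
    dotv (y i) (w i) - dotv (y i) (comb w l) - dotv (comb y l) (w i) + b.
  rewrite cb cb' /b -[dotv (y i) (w i)]mul1r -l1 mulr_suml -!sumrB -big_split.
  by apply: eq_bigr => j _; rewrite !dotv_lin /=; ring.
have E : \sum_i l 0 i * \sum_j l 0 j * dotv (y i - y j) (w i - w j) =
    2 * b - 2 * dotv (comb y l) (comb w l).
  under eq_bigr do rewrite inner !(mulrDr, mulrN).
  rewrite !big_split /= !sumrN -!mulr_suml l1 -/b -cb -cb'.
  ring.
have -> : dual l = b - dotv (comb mid l) (comb mid l) by [].
have -> : comb mid l = 2^-1 *: (comb y l + comb w l).
  rewrite /comb -big_split scaler_sumr; apply: eq_bigr => i _ /=.
  by rewrite /mid scalerA mulrC -scalerA scalerDr.
have := dotv_ge0 (comb y l - comb w l).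
move: h; rewrite E !dotv_lin (dotvC (comb w l) (comb y l)); lra.
Qed.

Lemma finite_minty : exists z, forall i, dotv (z - y i) (z - w i) <= 0.
Proof.
have [l lS lmax] := dual_max; have [l0 l1] := lS.
exists (comb mid l) => i; set z := comb mid l.
set b := \sum_j l 0 j * dotv (y j) (w j).
(* derivative of [dual] at [l] in the direction of the i-th vertex *)
pose A := dotv (y i) (w i) - b - 2 * dotv z (mid i - z).
suff A0 : A <= 0.
  have := dual_le0 lS; rewrite /dual -/b -/z; move: A0.
  rewrite /A /mid !dotv_lin (dotvC (y i) z); lra.
apply: (@le0_of_small_steps _ A (dotv (mid i - z) (mid i - z))) => t t0 t1.
pose lt : 'rV[R]_n.+1 := (1 - t) *: l + t *: delta_mx 0 i.
have sum_lt (V : lmodType R) (x : 'I_n.+1 -> V) :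
    \sum_j lt 0 j *: x j = (1 - t) *: (\sum_j l 0 j *: x j) + t *: x i.
  rewrite scaler_sumr.
  have -> : t *: x i = \sum_j (t * (i == j)%:R) *: x j.
    rewrite (bigD1 i)//= eqxx mulr1 big1 ?addr0// => j ji.
    by rewrite eq_sym (negbTE ji) mulr0 scale0r.
  rewrite -big_split; apply: eq_bigr => j _ /=.
  by rewrite !mxE eqxx /= eq_sym scalerA -scalerDl.
have ltS : simplex lt.
  split=> [j|].
    by rewrite !mxE addr_ge0 ?mulr_ge0 ?ler0n ?subr_ge0 ?(ltW t0).
  have := sum_lt R^o (fun=> 1); under eq_bigr do rewrite /GRing.scale /= mulr1.
  move=> ->; under eq_bigr do rewrite /GRing.scale /= mulr1.
  by rewrite l1 /GRing.scale /=; ring.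
have := lmax _ ltS; rewrite /dual -/b -/z.
have -> : comb mid lt = z + t *: (mid i - z).
  rewrite /comb sum_lt -/(comb mid l) -/z scalerBl scale1r scalerBr.
  by rewrite addrAC addrA.
have -> : \sum_j lt 0 j * dotv (y j) (w j) = (1 - t) * b + t * dotv (y i) (w i).
  exact: (sum_lt R^o (fun j => dotv (y j) (w j))).
rewrite /A; move: (mid i - z) => q.
by rewrite !dotv_lin (dotvC q z); lra.
Qed.

End FiniteMinty.

(** * Minty's theorem and properties of resolvents *)

Section Minty.
Variables (R : realType) (d : nat).
Implicit Types (A : operator R d) (x y z u v w : 'rV[R]_d).

Let ball_of y w : set 'rV[R]_d := [set z | dotv (z - y) (z - w) <= 0].

Lemma ball_of_closed y w : closed (ball_of y w).
Proof.
apply: (@preimage_closed _ _ (fun z => dotv (z - y) (z - w)) [set t | t <= 0]).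
  have c v : continuous (fun z : 'rV[R]_d => z - v).
    by move=> z; apply: (@continuousB _ _ _ id (cst v));
      [exact: cvg_id|exact: cst_continuous].
  by move=> z _; exact: (continuous_dotv (c y) (c w)).
exact: closed_le.
Qed.

Lemma ball_of_compact y w : compact (ball_of y w).
Proof.
apply: bounded_closed_compact; last exact: ball_of_closed.
exists (enorm (y + w) + enorm y * enorm w + 1); split; first exact: num_real.
move=> M /ltW hM z hz; apply: le_trans hM; apply: (le_trans (normr_le_enorm z)).
move: hz; rewrite /ball_of /= !dotv_lin (dotvC y z) -!enorm_sqr => hz.
have := cauchy_schwarz z (y + w); rewrite dotvDr => h1.
have h2 := cauchy_schwarzN y w.
have := mulr_ge0 (enorm_ge0 y) (enorm_ge0 w).
by have := enorm_ge0 z; have := enorm_ge0 (y + w); nra.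
Qed.

(** Each pair of the graph confines [z] to a closed ball; finitely many of these
    balls meet by [finite_minty], hence all of them do by compactness. *)
Lemma minty_extension A x : monotone_operator A ->
  exists z, forall y v, A y v -> 0 <= dotv (z - y) (x - z - v).
Proof.
move=> mA; have [[y0 [v0 Ayv0]]|noA] := pselect (exists y v, A y v); last first.
  by exists x => y v Ayv; case: noA; exists y, v.
pose B := ball_of y0 (x - v0).
pose D : set ('rV[R]_d * 'rV[R]_d) := [set p | A p.1 p.2].
have := @ball_of_compact y0 (x - v0).
rewrite compact_In0 => /(_ _ D (fun p => B `&` ball_of p.1 (x - p.2))).
case.
- exists (fun p => ball_of p.1 (x - p.2)) => // p _; exact: ball_of_closed.
- move=> D' D'D.
  (* the first pair is added to make the finite family nonempty *)
  pose s := (y0, v0) :: finmap.enum_fset D'.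
  pose p (i : 'I_(size (finmap.enum_fset D')).+1) := nth (y0, v0) s i.
  have Dp i : A (p i).1 (p i).2.
    have : p i \in s by rewrite mem_nth.
    by rewrite inE => /orP[/eqP->//|/D'D]; rewrite inE.
  have [|z hz] := @finite_minty R d (size (finmap.enum_fset D')) (fun i => (p i).1)
      (fun i => x - (p i).2).
    move=> i j; have := mA _ _ _ _ (Dp i) (Dp j).
    have -> : x - (p i).2 - (x - (p j).2) = - ((p i).2 - (p j).2).
      by apply/rowP => k; rewrite !mxE; ring.
    by rewrite dotvNr oppr_le0.
  exists z => q /= qD'; split; first exact: (hz ord0).
  have qs : q \in s by rewrite inE qD' orbT.
  have lt_q : (index q s < (size (finmap.enum_fset D')).+1)%N.
    by rewrite -[X in (_ < X)%N]/(size s) index_mem.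
  by have := hz (Ordinal lt_q); rewrite /p /= nth_index.
move=> z hz; exists z => y v Ayv.
have [_] := hz (y, v) Ayv; rewrite /ball_of /= => h.
rewrite -oppr_le0 -dotvNr; suff -> : - (x - z - v) = z - (x - v) by [].
by apply/rowP => k; rewrite !mxE; ring.
Qed.

(** The relation [z = (I + l A)^-1 x]. *)
Definition resolvent A (l : R) x z := A z (l^-1 *: (x - z)).

(** Adding the pair given by [minty_extension] to [A] keeps it monotone, so by
    maximality the pair was there already. *)
Lemma resolvent_exists A l x : maximal_monotone A -> 0 < l ->
  exists z, resolvent A l x z.
Proof.
move=> [mA maxA] l0.
pose lA : operator R d := fun y => [set l *: v | v in A y].
have mlA : monotone_operator lA.
  move=> y y' _ _ [v Av <-] [v' Av' <-].
  by rewrite -scalerBr dotvZr mulr_ge0 ?(ltW l0)//; exact: mA.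
have [z hz] := minty_extension x mlA; exists z.
pose A' : operator R d := fun y =>
  [set v | A y v \/ (y = z /\ v = l^-1 *: (x - z))].
have Az y v : A y v -> 0 <= dotv (z - y) (l^-1 *: (x - z) - v).
  move=> Ayv; have : lA y (l *: v) by exists v.
  move/hz; have -> : x - z - l *: v = l *: (l^-1 *: (x - z) - v).
    by rewrite scalerBr scalerA mulfV ?gt_eqF// scale1r.
  by rewrite dotvZr pmulr_rge0.
apply: (maxA A'); last by right.
  move=> y y' v v' [Av|[-> ->]] [Av'|[-> ->]]; first exact: mA.
  - by rewrite -(opprB z) dotvNl -dotvNr opprB; exact: Az.
  - exact: Az.
  - by rewrite subrr dotv0l.
by move=> y v Av; left.
Qed.

Lemma resolvent_firmly_nonexpansive A l x x' z z' :
  monotone_operator A -> 0 < l -> resolvent A l x z -> resolvent A l x' z' ->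
  dotv (z - z') (z - z') <= dotv (z - z') (x - x').
Proof.
move=> mA l0 hz hz'; have := mA _ _ _ _ hz hz'.
rewrite -scalerBr dotvZr pmulr_rge0 ?invr_gt0//.
by rewrite !dotv_lin; lra.
Qed.

(** Firm nonexpansiveness is symmetric in the resolvent and its complement [x - z],
    so the latter is nonexpansive too. *)
Lemma resolvent_residual_diff A l x x' z z' :
  monotone_operator A -> 0 < l -> resolvent A l x z -> resolvent A l x' z' ->
  enorm ((x - z) - (x' - z')) <= enorm (x - x').
Proof.
move=> mA l0 hz hz'; apply: enorm_dotv_le.
have := resolvent_firmly_nonexpansive mA l0 hz hz'; have := dotv_ge0 (z - z').
rewrite (_ : x - z - (x' - z') = (x - x') - (z - z')); last first.
  by apply/rowP => k; rewrite !mxE; ring.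
move: (z - z') (x - x') => p q.
by rewrite !dotv_lin (dotvC q p); lra.
Qed.

(** With [p] and [q] the two displacements, monotonicity of [A] and the
    Cauchy-Schwarz inequality give
    [(m * |p| - l * |q|) * (|p| - |q|) <= 0]; since [l <= m], the first factor must
    be nonnegative and the second nonpositive. *)
Lemma resolvent_monotone A (l m : R) x z z' :
  monotone_operator A -> 0 < l -> l <= m ->
  resolvent A l x z -> resolvent A m x z' ->
  enorm (z - x) <= enorm (z' - x) /\ l * enorm (z' - x) <= m * enorm (z - x).
Proof.
move=> mA l0 lm hz hz'; have m0 : 0 < m := lt_le_trans l0 lm.
have := mA _ _ _ _ hz hz'.
rewrite (_ : z - z' = (x - z') - (x - z)); last first.
  by apply/rowP => k; rewrite !mxE; ring.
rewrite -(enormC x) -(enormC x z'); move: (x - z) (x - z') => p q.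
move=> /(mulr_ge0 (mulr_ge0 (ltW l0) (ltW m0))).
rewrite !dotv_lin (dotvC p q) => h.
have {h} : 0 <= (l + m) * dotv q p - m * enorm p ^+ 2 - l * enorm q ^+ 2.
  rewrite !enorm_sqr; move: h; congr (0 <= _).
  by field; rewrite !gt_eqF.
have := cauchy_schwarz q p; have := enorm_ge0 p; have := enorm_ge0 q.
move: (enorm p) (enorm q) => a b b0 a0 qp h.
have {}h : (m * a - l * b) * (a - b) <= 0 by nra.
have ab : a <= b.
  rewrite leNgt; apply/negP => ba.
  have : 0 < (m * a - l * b) * (a - b) by rewrite mulr_gt0 ?subr_gt0//; nra.
  lra.
split=> //; rewrite leNgt; apply/negP => lb.
have {ab lb} : 0 < (m * a - l * b) * (a - b) by rewrite nmulr_rgt0 ?subr_lt0//; nra.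
lra.
Qed.

(** The cross term of the squared norm of [(l u - (x - z)) + (y - z)] is at least
    [- 2 l e], which is what the error criterion pays for. *)
Lemma enlargement_resolvent A l s x z y u e :
  0 < l -> 0 <= s -> resolvent A l x z -> enlargement e A y u ->
  enorm (l *: u + y - x) ^+ 2 + 2 * l * e <= s ^+ 2 * enorm (y - x) ^+ 2 ->
  enorm (y - z) <= s * enorm (y - x).
Proof.
move=> l0 s0 hz hu herr; apply: le_enorm; first by rewrite mulr_ge0 ?enorm_ge0.
rewrite exprMn; apply: le_trans herr.
have := hu _ _ hz; rewrite -(ler_pM2l l0) -dotvZr.
rewrite scalerBr scalerA mulfV ?gt_eqF// scale1r enorm_sqr.
rewrite (_ : l *: u + y - x = (l *: u - (x - z)) + (y - z)); last first.
  by apply/rowP => k; rewrite !mxE; ring.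
move: (l *: u - (x - z)) (y - z) => p q; have := dotv_ge0 p.
by rewrite !dotv_lin (dotvC p q); nra.
Qed.

End Minty.

(** * The Newton remainder *)

Lemma coef2_ge0 (R : realType) (a b c : R) :
  (forall t, 0 < t -> 0 <= a * t ^+ 2 + b * t + c) -> 0 <= a.
Proof.
move=> h; rewrite leNgt; apply/negP => a0.
pose k := `|b| + `|c| + 1.
have k1 : 1 <= k by have := normr_ge0 b; have := normr_ge0 c; rewrite /k; lra.
have t1 : 1 <= 1 - k / a.
  by rewrite lerDl oppr_ge0 mulr_ge0_le0 ?invr_le0 ?(ltW a0)//; lra.
have := h _ (lt_le_trans ltr01 t1).
have : a * (1 - k / a) = a - k by rewrite mulrBr mulr1 mulrCA mulfV ?mulr1// lt_eqF.
move: (1 - k / a) t1 => t t1 atE h1.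
have t0 : 0 < t := lt_le_trans ltr01 t1.
have hb : b * t <= `|b| * t by rewrite ler_wpM2r ?ler_norm// ltW.
have hc : c <= `|c| * t.
  by rewrite (le_trans (ler_norm c))// -[leLHS]mulr1 ler_wpM2l.
have : a * t < 0 by rewrite nmulr_rlt0.
rewrite /k in atE; have : a * t ^+ 2 = (a - (`|b| + `|c| + 1)) * t.
  by rewrite -atE expr2 mulrA.
lra.
Qed.

Section Newton.
Variables (R : realType) (d : nat) (G : 'rV[R]_d -> 'rV[R]_d) (L : R).
Hypothesis G_differentiable : forall x, differentiable G x.
Hypothesis dG_lipschitz : forall x y,
  opnorm (jacobian G x - jacobian G y) <= L * enorm (x - y).

(** The difference quotient of the restriction to a line is, up to a translation,
    the one defining the directional derivative of [G]. *)
Lemma is_derive_along x h u (t : R) :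
  is_derive t 1 (fun s : R => dotv (G (x + s *: h)) u)
    (dotv (h *m jacobian G (x + t *: h)) u).
Proof.
set a := x + t *: h; have dG : derivable G a h by exact: diff_derivable.
have coord i : is_derive t 1 (fun s : R => G (x + s *: h) 0 i)
    ((h *m jacobian G a) 0 i).
  have E : (fun s : R => s^-1 *: (G (s *: h + a) 0 i - G a 0 i)) =
      (fun s : R => s^-1 *: (G (x + (s *: 1 + t) *: h) 0 i - G a 0 i)).
    apply/funext => s; congr (_ *: (G _ 0 i - _)).
    by rewrite /a [s *: 1]mulr1 scalerDl addrCA.
  have /(derivable_mxP G a h) /(_ 0 i) dGi := dG.
  apply: DeriveDef; first by rewrite /derivable -E; exact: dGi.
  by rewrite -deriveEjacobian// derive_mx// mxE /derive E.
have -> : (fun s : R => dotv (G (x + s *: h)) u) =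
    \sum_i (u 0 i \*: (fun s : R => G (x + s *: h) 0 i)).
  apply/funext => s; rewrite dotvE fct_sumE.
  by apply: eq_bigr => i _; rewrite mulrC.
apply: (is_derive_eq (is_derive_sum (fun i => is_deriveZ (u 0 i) (coord i)))).
by rewrite dotvE; apply: eq_bigr => i _; rewrite mulrC.
Qed.

(** Subtracting the quadratic [K / 2 * s ^+ 2] makes the derivative nonpositive
    along the whole segment, so that the mean value theorem yields the bound with
    the factor one half. *)
Lemma newton_remainder_dual x h u :
  dotv (G (x + h) - G x - h *m jacobian G x) u
    <= L / 2 * enorm h ^+ 2 * enorm u.
Proof.
pose c := dotv (h *m jacobian G x) u; pose K := L * enorm h ^+ 2 * enorm u.
pose f (s : R) := dotv (G (x + s *: h)) u.
pose g : R -> R := f - (c \*: id) - ((K / 2) \*: (id ^+ 2)).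
have dg (s : R) : is_derive s 1 g
    (dotv (h *m jacobian G (x + s *: h)) u - c - K * s).
  have df : is_derive s 1 f _ := is_derive_along x h u s.
  apply: is_derive_eq; rewrite /GRing.scale /= expr1 !mulr1.
  by field.
have [|s] := @MVT R g _ 0 1 ltr01 (fun s _ => dg s).
  apply: derivable_within_continuous => s _.
  exact: (@ex_derive _ _ _ _ _ _ _ (dg s)).
rewrite in_itv /= => /andP[s0 s1].
have -> : g 1 - g 0 = dotv (G (x + h) - G x - h *m jacobian G x) u - K / 2.
  rewrite /g /f !fctE /= !scale1r scale0r addr0 !dotv_lin -/c /GRing.scale /=.
  by rewrite expr0n expr1n /=; ring.
have J : dotv (h *m jacobian G (x + s *: h)) u - c <= K * s.
  rewrite /c -dotvNl -dotvDl -mulmxBr.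
  apply: (le_trans (cauchy_schwarz _ _)).
  rewrite /K mulrAC ler_wpM2r ?enorm_ge0//.
  apply: (le_trans (enorm_mulmx_le _ _)).
  have xh : x + s *: h - x = s *: h by rewrite addrAC subrr add0r.
  have := dG_lipschitz (x + s *: h) x; rewrite xh enormZ ?(ltW s0)//.
  move=> /(ler_wpM2r (enorm_ge0 h)) /le_trans; apply; lra.
by move=> E; have : dotv (G (x + h) - G x - h *m jacobian G x) u - K / 2 <= 0;
  [rewrite E; lra|rewrite /K; lra].
Qed.

Lemma newton_remainder x y :
  enorm (G y - G x - (y - x) *m jacobian G x) <= L / 2 * enorm (y - x) ^+ 2.
Proof.
have [->|yx] := eqVneq y x.
  by rewrite !subrr mul0mx subr0 /enorm dotv0l sqrtr0 expr0n mulr0.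
set v := G y - _ - _; have [v0|v0] := eqVneq (enorm v) 0.
  (* the Lipschitz bound at two distinct points makes [L] nonnegative *)
  have xy_gt0 : 0 < enorm (y - x).
    rewrite lt_neqAle enorm_ge0 andbT eq_sym; apply: contraNneq yx => /enorm_eq0.
    by move/eqP; rewrite subr_eq0.
  have := le_trans (opnorm_ge0 _) (dG_lipschitz y x).
  by rewrite v0 pmulr_lge0// => L0; rewrite mulr_ge0 ?sqr_ge0// divr_ge0.
have v_gt0 : 0 < enorm v by rewrite lt_neqAle eq_sym v0 enorm_ge0.
rewrite -(ler_pM2r v_gt0) -expr2 (enorm_sqr v).
have := newton_remainder_dual x (y - x) v; rewrite subrKC; exact.
Qed.

(** Expand the monotonicity inequality between [x] and [x + t^-1 v] as [t] tends
    to infinity: the quadratic form dominates the Newton remainder. *)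
Lemma jacobian_monotone x v :
  monotone_operator (single_valued G) -> 0 <= dotv (v *m jacobian G x) v.
Proof.
move=> mG; pose K := L / 2 * enorm v ^+ 2 * enorm v.
apply: (@coef2_ge0 _ _ K 0) => t t0; rewrite addr0.
have s0 : 0 < t^-1 by rewrite invr_gt0.
have := mG (x + t^-1 *: v) x _ _ erefl erefl.
rewrite (_ : x + t^-1 *: v - x = t^-1 *: v); last by rewrite addrAC subrr add0r.
rewrite dotvZl pmulr_rge0// dotvC.
have := newton_remainder_dual x (t^-1 *: v) v.
rewrite enormZ ?(ltW s0)// -scalemxAl dotvDl dotvNl dotvZl.
move: (dotv (G _ - _) _) => g h1 g0.
have : 0 <= t ^+ 2 * (t^-1 * dotv (v *m jacobian G x) v
    + L / 2 * (t^-1 * enorm v) ^+ 2 * enorm v) * t.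
  by rewrite !mulr_ge0 ?sqr_ge0 ?(ltW t0)//; lra.
congr (0 <= _); rewrite /K; field.
by rewrite gt_eqF.
Qed.

End Newton.

(** * Linearized problems *)

(** The hypothesis places [p] in the ball having [0] and [b + g] as antipodal
    points. *)
Lemma enorm_sub_le_of_ball (R : realType) (d : nat) (p b g : 'rV[R]_d) :
  dotv p p <= dotv p (b + g) -> enorm (p - b) <= enorm b + enorm g.
Proof.
move=> pp; have h1 : enorm (2 *: p - (b + g)) <= enorm (b + g).
  apply: enorm_dotv_le; move: (b + g) pp => c pp.
  by rewrite !dotv_lin (dotvC c p); lra.
have := enormD (2 *: p - (b + g)) (g - b).
have := enormD b g; have := enormB g b.
have -> : 2 *: p - (b + g) + (g - b) = 2 *: (p - b).
  by apply/rowP => k; rewrite !mxE; ring.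
by rewrite enormZ//; lra.
Qed.

Definition model_operator (R : realType) (d : nat) (G : 'rV[R]_d -> 'rV[R]_d)
    (P : 'rV[R]_d -> 'M[R]_d) (H : operator R d) (x : 'rV[R]_d) : operator R d :=
  operator_add (single_valued (model G P x)) H.

Section Model.
Variables (R : realType) (d : nat).
Variables (G : 'rV[R]_d -> 'rV[R]_d) (P : 'rV[R]_d -> 'M[R]_d) (H : operator R d).
Variables (L2 L' delta : R).
Hypothesis G_monotone : monotone_operator (single_valued G).
Hypothesis G_differentiable : forall x, differentiable G x.
Hypothesis dG_lipschitz : forall x y,
  opnorm (jacobian G x - jacobian G y) <= L2 * enorm (x - y).
Hypothesis H_maximal : maximal_monotone H.
Hypothesis H_bounded : forall x w, H x w -> enorm w <= L'.
Hypothesis P_approx : forall x, opnorm (P x - jacobian G x) < delta.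
Hypothesis P_lipschitz : forall x y, opnorm (P x - P y) <= L2 * enorm (x - y).
Hypothesis P_maximal : forall x,
  maximal_monotone (model_operator G P H x).

Local Notation T := (model_operator G P H).

Let mem_model x y w : H y w -> T x y (model G P x y + w).
Proof. by move=> hw; exists (model G P x y) => //; exists w. Qed.

(** The resolvents of [H] at [t v] and at [0] are within [L'] of these points, so
    they differ by [t v] up to a bounded vector.  In the monotonicity inequality
    between them, [P x] contributes the square of [t] times the quadratic form at
    [v], and [H] at most a multiple of [t]. *)
Lemma model_psd x v : 0 <= dotv (v *m P x) v.
Proof.
have [z0 hz0] := resolvent_exists 0 H_maximal ltr01.
have L'0 : 0 <= L' := le_trans (enorm_ge0 _) (H_bounded hz0).
pose N := opnorm (P x); have N0 : 0 <= N := opnorm_ge0 _.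
pose K := 2 * L'; have K0 : 0 <= K by rewrite mulr_ge0.
apply: (@coef2_ge0 _ _ (2 * N * enorm v * K + enorm v * K) (N * K ^+ 2 + K ^+ 2)).
move=> t t0; have [z hz] := resolvent_exists (t *: v) H_maximal ltr01.
have := H_bounded hz; have := H_bounded hz0; rewrite invr1 !scale1r => b0 b.
have := (P_maximal x).1 _ _ _ _ (mem_model x hz) (mem_model x hz0).
rewrite invr1 !scale1r.
have -> : model G P x z + (t *: v - z) - (model G P x z0 + (0 - z0)) =
    (z - z0) *m P x + ((t *: v - z) - (0 - z0)).
  rewrite /model.
  rewrite (_ : (z - z0) *m P x = (z - x) *m P x - (z0 - x) *m P x); last first.
    by rewrite -mulmxBl opprB addrA subrK.
  by apply/rowP => k; rewrite !mxE; ring.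
pose r := (t *: v - z) - (0 - z0).
have r_le : enorm r <= K by rewrite (le_trans (enormB _ _))// /K; lra.
have -> : z - z0 = t *: v - r by apply/rowP => k; rewrite /r !mxE; ring.
rewrite -/r; move: r r_le => r r_le.
rewrite mulmxBl -scalemxAl !dotv_lin (dotvC v (v *m P x)).
have Nv := enorm_mulmx_le (P x) v; have Nr := enorm_mulmx_le (P x) r.
have h1 := cauchy_schwarzN v (r *m P x); have h2 := cauchy_schwarzN r (v *m P x).
have h3 := cauchy_schwarz r (r *m P x); have h4 := cauchy_schwarz v r.
have h5 := dotv_ge0 r.
have v0 := enorm_ge0 v; have r0 := enorm_ge0 r.
have k1 : enorm v * enorm (r *m P x) <= enorm v * (N * K).
  by rewrite ler_wpM2l// (le_trans Nr)// ler_wpM2l.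
have k2 : enorm r * enorm (v *m P x) <= K * (N * enorm v).
  by rewrite ler_pM ?enorm_ge0.
have k3 : enorm r * enorm (r *m P x) <= K * (N * K).
  by rewrite ler_pM ?enorm_ge0// (le_trans Nr)// ler_wpM2l.
have k4 : enorm v * enorm r <= enorm v * K by rewrite ler_wpM2l.
move: (dotv v (r *m P x)) (dotv r (v *m P x)) (dotv r (r *m P x)) (dotv v r)
  h1 h2 h3 h4 => A B C D h1 h2 h3 h4 h.
have l1 : t * - A <= t * (enorm v * (N * K)) by rewrite ler_wpM2l ?(ltW t0)//; lra.
have l2 : t * - B <= t * (K * (N * enorm v)) by rewrite ler_wpM2l ?(ltW t0)//; lra.
have l4 : t * D <= t * (enorm v * K) by rewrite ler_wpM2l ?(ltW t0)//; lra.
have K20 := sqr_ge0 K.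
lra.
Qed.

(** Since [P x] is monotone, the enlargement of [H] plus the model is contained in
    the enlargement of [T x]; hence the approximate solution is within
    [s * enorm (y - x)] of the exact one. *)
Lemma newton_step_bounds s l x y u e z : 0 < l -> 0 <= s ->
  resolvent (T x) l x z -> approx_newton_solution G P H s l x y u e ->
  (1 - s) * enorm (y - x) <= enorm (z - x) <= (1 + s) * enorm (y - x).
Proof.
move=> l0 s0 hz [e0 [_ -> [h hh <-]] herr].
have enl : enlargement e (T x) y (model G P x y + h).
  move=> y' _ [_ -> [h' hh' <-]].
  rewrite opprD addrACA dotvDr -[leLHS]add0r; apply: lerD; last exact: hh.
  have := model_psd x (y - y'); rewrite dotvC; congr (0 <= dotv _ _).
  rewrite /model opprD addrACA subrr add0r -mulmxBl; congr (_ *m _).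
  by rewrite opprB addrA subrK.
have := enlargement_resolvent l0 s0 hz enl herr.
have := enormD (y - z) (z - x); rewrite subrKA.
have := enormD (z - y) (y - x); rewrite subrKA (enormC z y).
by move=> *; apply/andP; split; lra.
Qed.

(** The two models differ by a Newton remainder at [x'], the error of [P x'] and the
    variation of [P]. *)
Lemma model_diff x x' y :
  enorm (model G P x' y - model G P x y) <=
    L2 / 2 * enorm (x - x') ^+ 2 + delta * enorm (x - x')
    + L2 * enorm (x - x') * enorm (y - x).
Proof.
have -> : model G P x' y - model G P x y =
    - (G x - G x' - (x - x') *m jacobian G x')
    + (x - x') *m (P x' - jacobian G x') + (y - x) *m (P x' - P x).
  rewrite /model (_ : y - x' = (x - x') + (y - x)); last first.
    by apply/rowP => k; rewrite !mxE; ring.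
  rewrite !mulmxBr !mulmxDl.
  by apply/rowP => k; rewrite !mxE; ring.
apply: (le_trans (enormD _ _)); apply: lerD; last first.
  apply: (le_trans (enorm_mulmx_le _ _)); rewrite ler_wpM2r ?enorm_ge0//.
  by rewrite (enormC x).
apply: (le_trans (enormD _ _)); apply: lerD.
  by rewrite enormN; exact: newton_remainder.
by apply: (le_trans (enorm_mulmx_le _ _)); rewrite ler_wpM2r ?enorm_ge0// ltW.
Qed.

(** The solution for base point [x] is also a solution of the problem linearized
    at [x'], with the right-hand side [x] perturbed by [l] times the difference of
    the models; nonexpansiveness of the residual does the rest. *)
Lemma resolvent_change_base C l x x' z z' : 0 < l -> l * delta <= C ->
  resolvent (T x) l x z -> resolvent (T x') l x' z' ->
  l * enorm (z' - x') <= l * enorm (z - x) + (1 + 2 * C) * (l * enorm (x - x'))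
    + L2 * (l * enorm (x - x')) ^+ 2
    + 2 * L2 * (l * enorm (x - x')) * (l * enorm (z - x)).
Proof.
move=> l0 lC hz hz'; pose e := model G P x' z - model G P x z.
have hze : resolvent (T x') l (x + l *: e) z.
  have [_ -> [w hw E]] := hz; rewrite /resolvent.
  have -> : x + l *: e - z = (x - z) + l *: e by rewrite addrAC.
  rewrite scalerDr scalerA mulVf ?gt_eqF// scale1r -E.
  have -> : model G P x z + w + e = model G P x' z + w.
    by apply/rowP => k; rewrite /e !mxE; ring.
  exact: mem_model.
have h1 := resolvent_residual_diff (P_maximal x').1 l0 hze hz'.
have h2 := enormB (x + l *: e - z) (x + l *: e - z - (x' - z')).
rewrite subKr in h2.
have h3 := enormD (x - z) (l *: e); have h4 := enormD (x - x') (l *: e).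
rewrite addrAC enormZ ?(ltW l0)// in h3; rewrite addrAC enormZ ?(ltW l0)// in h4.
have he := model_diff x x' z; rewrite -/e in he.
rewrite -(enormC x z) in he *; rewrite -(enormC x' z').
have D0 := enorm_ge0 (x - x').
have h5 : enorm (x' - z') <=
  enorm (x - z) + enorm (x - x') + 2 * (l * enorm e) by lra.
have h6 : l * enorm e <= l * (L2 / 2 * enorm (x - x') ^+ 2
    + delta * enorm (x - x') + L2 * enorm (x - x') * enorm (x - z)).
  by rewrite ler_wpM2l// ltW.
have h7 : l * delta * enorm (x - x') <= C * enorm (x - x') by rewrite ler_wpM2r.
have : l * enorm (x' - z') <= l * (enorm (x - z) + enorm (x - x')
   + 2 * (C * enorm (x - x')) + l * L2 * enorm (x - x') ^+ 2
   + 2 * l * L2 * enorm (x - x') * enorm (x - z)).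
  by rewrite ler_wpM2l ?(ltW l0)//; lra.
by lra.
Qed.

(** Comparing the inclusions at [z] and at the zero [xs], with the Jacobian of [G]
    at [x] in place of [P x], leaves an equation [(1 + l M) p = b + g] where [M] is
    monotone, [b = x - xs], [p = z - xs], and [g] collects the Newton remainder,
    the difference of two values of [H], and the error of [P].  That error is
    proportional to [enorm (z - x)] and is absorbed by the factor [1 - C]. *)
Lemma resolvent_dist_zero C l x xs z : 0 < l -> l * delta <= C ->
  operator_add (single_valued G) H xs 0 -> resolvent (T x) l x z ->
  (1 - C) * enorm (z - x) <=
    2 * L' * l + enorm (x - xs) + l * (L2 / 2 * enorm (x - xs) ^+ 2).
Proof.
move=> l0 lC [_ -> [ws hws E0]] [_ -> [w hw E]].
set M := jacobian G x; pose q := z - x; pose b := x - xs; pose p := q + b.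
pose r := G xs - G x - (xs - x) *m M.
pose g := l *: (r - (w - ws) - q *m (P x - M)).
have g_le : enorm g <= l * (L2 / 2 * enorm b ^+ 2 + 2 * L' + delta * enorm q).
  rewrite enormZ ?(ltW l0)// ler_wpM2l ?(ltW l0)//.
  apply: (le_trans (enormB _ _)); apply: lerD; last first.
    by apply: (le_trans (enorm_mulmx_le _ _)); rewrite ler_wpM2r ?enorm_ge0// ltW.
  apply: (le_trans (enormB _ _)); apply: lerD.
    by rewrite /b (enormC x); exact: newton_remainder.
  by have := enormB w ws; have := H_bounded hw; have := H_bounded hws; lra.
(* the inclusion at [z], recentred at the zero [xs] *)
have eqp : l *: (p *m M) = b + g - p.
  have lE : l *: (model G P x z + w) = - q.
    by rewrite E scalerA mulfV ?gt_eqF// scale1r /q opprB.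
  have Gxs : G xs = - ws by apply/eqP; rewrite -addr_eq0 E0.
  have xsM : (xs - x) *m M = - (b *m M) by rewrite -mulNmx opprB.
  have -> : b + g - p = l *: (model G P x z + w) + g.
    by rewrite lE; apply/rowP => k; rewrite /p !mxE; ring.
  rewrite -scalerDr; congr (_ *: _).
  rewrite /p /r mulmxDl mulmxBr xsM Gxs /model -/q.
  by apply/rowP => k; rewrite !mxE; ring.
have pp : dotv p p <= dotv p (b + g).
  have := jacobian_monotone G_differentiable dG_lipschitz x p G_monotone.
  rewrite -(pmulr_rge0 _ l0) -dotvZl -/M eqp dotvDl dotvNl (dotvC (b + g)); lra.
have := enorm_sub_le_of_ball pp.
have -> : p - b = q by rewrite /p addrK.
have q0 := enorm_ge0 q.
have : l * delta * enorm q <= C * enorm q by rewrite ler_wpM2r.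
by rewrite -/q -/b; lra.
Qed.

(** First move the base point from [x] to [x'] at parameter [l], then increase the
    parameter to [m] at the fixed base point [x']. *)
Lemma resolvent_growth C l m a rho x x' z z' :
  0 <= L2 -> 0 <= C -> 0 < l -> l <= m -> l * delta <= C ->
  resolvent (T x) l x z -> resolvent (T x') m x' z' ->
  l * enorm (z - x) <= a -> l * enorm (x - x') <= rho ->
  l ^+ 2 * (m * enorm (z' - x')) <=
    m ^+ 2 * (a + (1 + 2 * C) * rho + L2 * rho ^+ 2 + 2 * L2 * rho * a).
Proof.
move=> L20 C0 l0 lm lC hz hz' za xx'.
have m0 : 0 < m := lt_le_trans l0 lm.
have [w hw] := resolvent_exists x' (P_maximal x') l0.
have [_ wz'] := resolvent_monotone (P_maximal x').1 l0 lm hw hz'.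
have xx'0 : 0 <= l * enorm (x - x') by rewrite mulr_ge0 ?enorm_ge0// ltW.
have zx0 : 0 <= l * enorm (z - x) by rewrite mulr_ge0 ?enorm_ge0// ltW.
have wx' := resolvent_change_base l0 lC hz hw.
apply: (@le_trans _ _ (m ^+ 2 * (l * enorm (w - x')))).
  by have : 0 <= l * m by [rewrite mulr_ge0// ltW]; nra.
rewrite ler_wpM2l ?sqr_ge0//; apply: (le_trans wx').
set D := l * enorm (x - x') in xx' xx'0 *; set N := l * enorm (z - x) in za zx0 *.
apply: lerD; last first.
  have LL : 0 <= 2 * L2 by rewrite mulr_ge0.
  by apply: ler_pM => //; [rewrite mulr_ge0|rewrite ler_wpM2l].
apply: lerD; last by rewrite ler_wpM2l// ler_pXn2r// nnegrE (le_trans xx'0).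
by apply: lerD => //; rewrite ler_wpM2l// addr_ge0// mulr_ge0.
Qed.

End Model.

(** * Counting the steps of the bisection *)

(** Once [l ^+ 2 * a] is subtracted, every term of the right-hand side is bounded by
    a multiple of [m - l].  The term [(m ^+ 2 - l ^+ 2) * a], at most
    [2 * hi * a * (m - l)], is the origin of the summand [1 / (M0 * hi)]; the
    factor [C0 ^+ 2] comes from dividing by [l ^+ 2]. *)
Lemma bracket_gap (R : realType) (L2 C M0 C0 a b l m hi : R) :
  0 <= L2 -> 0 <= C -> 0 < M0 -> 0 <= a -> 0 < l -> l <= m -> m <= hi ->
  hi <= C0 * l ->
  l ^+ 2 * b <= m ^+ 2 * (a + (1 + 2 * C) * (M0 * (m - l))
    + L2 * (M0 * (m - l)) ^+ 2 + 2 * L2 * (M0 * (m - l)) * a) ->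
  b - a <= C0 ^+ 2 * M0 * (1 + 2 * C + L2 * M0 * hi
    + 2 * (L2 + 1 / (M0 * hi)) * a) * (m - l).
Proof.
move=> L20 Cge0 M00 a0 l0 lm mhi hiC0 h.
have m0 : 0 < m := lt_le_trans l0 lm; have hi0 : 0 < hi := lt_le_trans m0 mhi.
pose q := 1 + 2 * C + L2 * M0 * hi + 2 * L2 * a.
pose K := M0 * q + 2 * a / hi.
have -> : C0 ^+ 2 * M0 * (1 + 2 * C + L2 * M0 * hi
    + 2 * (L2 + 1 / (M0 * hi)) * a) * (m - l) = C0 ^+ 2 * K * (m - l).
  by rewrite /K /q; field; rewrite !gt_eqF.
have ml0 : 0 <= m - l by rewrite subr_ge0.
have q0 : 0 <= q.
  by rewrite /q !addr_ge0 ?mulr_ge0// ltW.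
have qm : (1 + 2 * C) * (M0 * (m - l)) + L2 * (M0 * (m - l)) ^+ 2
    + 2 * L2 * (M0 * (m - l)) * a <= M0 * (m - l) * q.
  have : L2 * (M0 * (m - l)) ^+ 2 <= M0 * (m - l) * (L2 * M0 * hi).
    rewrite (_ : L2 * _ ^+ 2 = M0 * (m - l) * (L2 * M0 * (m - l))); last by ring.
    rewrite ler_wpM2l ?mulr_ge0 ?(ltW M00)// ler_wpM2l ?mulr_ge0 ?(ltW M00)//.
    by lra.
  by rewrite /q; lra.
have m2hi : m ^+ 2 <= hi ^+ 2 by rewrite ler_pXn2r ?nnegrE ?(ltW m0) ?(ltW hi0).
have [M0' hi'] := (ltW M00, ltW hi0).
have K0 : 0 <= K by rewrite /K addr_ge0 ?divr_ge0 ?mulr_ge0.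
have hiK : hi ^+ 2 * K = hi ^+ 2 * (M0 * q) + 2 * hi * a.
  by rewrite /K; field; rewrite gt_eqF.
have l2 : 0 < l ^+ 2 by rewrite exprn_gt0.
rewrite -(ler_pM2l l2); apply: (@le_trans _ _ (hi ^+ 2 * K * (m - l))).
  rewrite {}hiK; clear K K0; clearbody q.
  have : m ^+ 2 * (M0 * (m - l) * q) <= hi ^+ 2 * (M0 * (m - l) * q).
    by rewrite ler_wpM2r ?mulr_ge0 ?(ltW M00).
  have : m ^+ 2 * ((1 + 2 * C) * (M0 * (m - l)) + L2 * (M0 * (m - l)) ^+ 2
    + 2 * L2 * (M0 * (m - l)) * a) <= m ^+ 2 * (M0 * (m - l) * q).
    by rewrite ler_wpM2l ?sqr_ge0.
  have : (m ^+ 2 - l ^+ 2) * a <= 2 * hi * (m - l) * a.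
    rewrite ler_wpM2r// subr_sqr [leRHS]mulrC ler_wpM2l// mulrDl !mul1r.
    exact: lerD (le_trans lm mhi).
  by clear qm; lra.
rewrite (_ : l ^+ 2 * _ = (C0 * l) ^+ 2 * K * (m - l)); last by ring.
rewrite ler_wpM2r// ler_wpM2r// ler_pXn2r ?nnegrE ?(ltW hi0)//.
exact: le_trans (ltW hi0) hiC0.
Qed.

(** Every call but the last halves the bracket and preserves the two endpoint
    properties, under which the bracket cannot be shorter than [D / K].  The last
    call, which stops the search, accounts for the factor 2. *)
Lemma bisection_calls_le (R : realType) (d : nat)
    (oracle : R -> 'rV[R]_d -> 'rV[R]_d -> 'rV[R]_d -> R -> Prop)
    (xt : R -> 'rV[R]_d) (am ap lo hi D K : R) (left right : R -> Prop) :
  0 <= K ->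
  (forall l y u e, lo <= l -> oracle l (xt l) y u e ->
    l * enorm (y - xt l) < am -> left l) ->
  (forall l y u e, lo <= l -> oracle l (xt l) y u e ->
    ap < l * enorm (y - xt l) -> right l) ->
  (forall l m, lo <= l -> l <= m -> m <= hi -> left l -> right m ->
    D <= K * (m - l)) ->
  forall l m n, bisection_calls oracle xt am ap l m n ->
    lo <= l -> l <= m -> m <= hi -> left l -> right m ->
    D * 2 ^+ n <= 2 * K * (m - l).
Proof.
move=> K0 toleft toright gap l m n; elim=> {l m n}
  [l m|l m k y u e kE hk _|l m k y u e n kE hk hy _ IH|l m k y u e n kE hk hy _ IH]
  lol lm mhi hl hm.
- have := gap _ _ lol lm mhi hl hm.
  have : 0 <= K * (m - l) by rewrite mulr_ge0// subr_ge0.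
  by rewrite expr0; lra.
- by have := gap _ _ lol lm mhi hl hm; rewrite expr1; lra.
- have [lk km] : l <= k /\ k <= m by rewrite kE; split; lra.
  have := IH lol lk (le_trans km mhi) hl (toright _ _ _ _ (le_trans lol lk) hk hy).
  by rewrite exprS kE; lra.
- have [lk km] : l <= k /\ k <= m by rewrite kE; split; lra.
  have := IH (le_trans lol lk) km mhi (toleft _ _ _ _ (le_trans lol lk) hk hy) hm.
  by rewrite exprS kE; lra.
Qed.

Lemma le_log2_of_pow (R : realType) (n k : nat) (X : R) :
  0 < X -> 2 ^+ n <= 2 ^+ k * X -> n%:R <= k%:R + log2 X.
Proof.
move=> X0 h; have ln2 : 0 < ln (2 : R) by rewrite ln_gt0 ?ltr1n.
rewrite /log2 -(ler_pM2r ln2) mulrDl divfK ?gt_eqF// !mulr_natl.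
have p2 j : (0 : R) < 2 ^+ j by rewrite exprn_gt0.
rewrite -!lnXn// -lnM ?posrE// ler_ln ?posrE//.
by rewrite mulr_gt0.
Qed.

(** * The complexity bound *)

(** The denominator in [lm] is chosen so that [lm / hi] times it, which bounds the
    residual at [lm] after the change of base point, is exactly
    [(1 - sigma) * am]. *)
Lemma left_endpoint_residual_le (R : realType) (L2 C g sigma am hi Y Q p D : R) :
  0 <= L2 -> 0 <= C -> 0 < hi -> 0 <= g -> 0 <= Y -> 0 <= sigma ->
  Q = (1 + sigma) * (1 + 2 * L2 * g) * hi * Y + (1 + 2 * C) * g + L2 * g ^+ 2 ->
  0 < Q -> 0 <= (1 - sigma) * am <= Q ->
  let lm := (1 - sigma) * am * hi / Q in
  0 <= p -> p <= lm * ((1 + sigma) * Y) -> 0 <= D -> D <= lm / hi * g ->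
  p + (1 + 2 * C) * D + L2 * D ^+ 2 + 2 * L2 * D * p <= (1 - sigma) * am.
Proof.
move=> L20 C0 hi0 g0 Y0 s0 QE Q0 /andP[am0 amQ] lm p0 pY D0 Dg.
pose t := (1 - sigma) * am / Q.
have [t0 t1] : 0 <= t /\ t <= 1.
  by split; [rewrite divr_ge0// ltW|rewrite ler_pdivrMr// mul1r].
have tQ : t * Q = (1 - sigma) * am by rewrite divfK// gt_eqF.
have {}pY : p <= t * (hi * (1 + sigma) * Y).
  by apply: (le_trans pY); rewrite /lm /t; apply/eqP/eqP; lra.
have {}Dg : D <= t * g.
  apply: (le_trans Dg); rewrite (_ : lm / hi = t)// /lm /t.
  by field; rewrite !gt_eqF.
have B0 : 0 <= hi * (1 + sigma) * Y by rewrite !mulr_ge0 ?addr_ge0// ltW.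
have D2 : L2 * D ^+ 2 <= t * (L2 * g ^+ 2).
  apply: (@le_trans _ _ (L2 * (t * g) ^+ 2)).
    by rewrite ler_wpM2l// ler_pXn2r// nnegrE (le_trans D0).
  rewrite (_ : L2 * _ = t * (t * (L2 * g ^+ 2))); last by ring.
  by rewrite ler_wpM2l// ler_piMl// mulr_ge0// sqr_ge0.
have Dp : 2 * L2 * D * p <= t * (2 * L2 * g * (hi * (1 + sigma) * Y)).
  apply: (@le_trans _ _ (2 * L2 * (t * g) * (t * (hi * (1 + sigma) * Y)))).
    have DP : D * p <= t * g * (t * (hi * (1 + sigma) * Y)) by apply: ler_pM.
    by rewrite -mulrA -[leRHS]mulrA ler_wpM2l ?mulr_ge0.
  rewrite (_ : 2 * L2 * (t * g) * _ =
    t * (t * (2 * L2 * g * (hi * (1 + sigma) * Y)))); last by ring.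
  by rewrite ler_wpM2l// ler_piMl// mulr_ge0// !mulr_ge0.
have CD : (1 + 2 * C) * D <= t * ((1 + 2 * C) * g).
  by rewrite mulrCA ler_wpM2l// addr_ge0// mulr_ge0.
by rewrite -tQ QE; clear lm tQ QE Q0 amQ; clearbody t; lra.
Qed.

Theorem theorem4p1 (R : realType) (d : nat)
  (G : 'rV[R]_d -> 'rV[R]_d) (H : operator R d) (P : 'rV[R]_d -> 'M[R]_d)
  (xs : 'rV[R]_d) (L2 L' sigma C delta am ap M0 M1 : R) (xt : R -> 'rV[R]_d)
  (G_monotone : monotone_operator (single_valued G))
  (G_differentiable : forall x, differentiable G x)
  (dG_lipschitz : forall x y,
    opnorm (jacobian G x - jacobian G y) <= L2 * enorm (x - y))
  (H_maximal : maximal_monotone H)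
  (H_bounded : forall x w, H x w -> enorm w <= L')
  (xs_zero : operator_add (single_valued G) H xs 0)
  (P_approx : forall x, opnorm (P x - jacobian G x) < delta)
  (P_lipschitz : forall x y, opnorm (P x - P y) <= L2 * enorm (x - y))
  (P_maximal : forall x,
    maximal_monotone (operator_add (single_valued (model G P x)) H))
  (sigma_bounds : 0 < sigma < 1) (C_bounds : 0 < C < 1) (delta_gt0 : 0 < delta)
  (am_gt0 : 0 < am) (am_lt_ap : am < ap)
  (alpha_gap : am * (1 + sigma) < ap * (1 - sigma))
  (M0_gt0 : 0 < M0) (M1_gt0 : 0 < M1)
  (xt_curve : forall s t : R, 0 < t -> t <= s ->
    enorm (xt s - xt t)
      <= Num.min (M0 / t * (s - t)) (M1 * enorm (xt s - xt 0)))
  (lp : R) (lp_gt0 : 0 < lp) (lp_delta : lp * delta = C)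
  (xp yp up : 'rV[R]_d) (ep : R) (xp_def : xp = xt lp)
  (ansp : approx_newton_solution G P H sigma lp xp yp up ep)
  (lp_large : ap < lp * enorm (yp - xp))
  (gamma0 lm : R) (gamma0_def : gamma0 = M1 * lp * enorm (xp - xt 0))
  (lm_def : lm =
    (1 - sigma) * am * lp /
    ((1 + sigma) * (1 + 2 * L2 * gamma0) * lp * enorm (yp - xp)
      + (1 + 2 * C) * gamma0 + L2 * gamma0 ^+ 2))
  (ym um : 'rV[R]_d) (em : R)
  (ansm : approx_newton_solution G P H sigma lm (xt lm) ym um em)
  (dp C0 : R) (dp_def : dp = enorm (xp - xs))
  (C0_def : C0 =
    ((1 + sigma) * (1 + 2 * L2 * gamma0)
       * (2 * L' * lp ^+ 2 + lp * dp + lp ^+ 2 * L2 * dp ^+ 2)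
      + ((1 + 2 * C) * gamma0 + L2 * gamma0 ^+ 2) * (1 - C) * (1 - sigma))
    / ((1 - C) * (1 - sigma) ^+ 2 * am)) :
  forall n : nat,
    bisection_calls (approx_newton_solution G P H sigma) xt am ap lm lp n ->
    n%:R <= 2 + log2 (C0 ^+ 2 * M0 * lp *
      ((1 + 2 * C + L2 * M0 * lp
          + 2 * (L2 + 1 / (M0 * lp)) * (1 + sigma) * am)
        / ((1 - sigma) * ap - (1 + sigma) * am))).
Proof.
have [[s0 s1] [Cgt0 C1]] := (andP sigma_bounds, andP C_bounds).
have s0' := ltW s0; have C0' := ltW Cgt0; have M0' := ltW M0_gt0.
set Y := enorm (yp - xp) in lp_large lm_def; have Y0 : 0 <= Y := enorm_ge0 _.
have ap0 : 0 < ap := lt_trans am_gt0 am_lt_ap.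
have Ypos : 0 < Y by rewrite -(pmulr_rgt0 _ lp_gt0) (lt_trans ap0).
have L20 : 0 <= L2.
  by have := le_trans (opnorm_ge0 _) (dG_lipschitz yp xp); rewrite pmulr_lge0.
have g0 : 0 <= gamma0 by rewrite gamma0_def !mulr_ge0 ?enorm_ge0// ltW.
have s1' : 0 < 1 - sigma by rewrite subr_gt0.
have C1' : 0 < 1 - C by rewrite subr_gt0.
pose T := model_operator G P H.
have T_max x : maximal_monotone (T x) := P_maximal x.
have lC l : l <= lp -> l * delta <= C.
  by move=> llp; rewrite -lp_delta ler_wpM2r// ltW.
(* the denominator of [lm], that is, [(1 - sigma) * am * lp / lm] *)
pose Q := (1 + sigma) * (1 + 2 * L2 * gamma0) * lp * Y + (1 + 2 * C) * gamma0
  + L2 * gamma0 ^+ 2.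
have apQ : ap <= Q.
  apply: (le_trans (ltW lp_large)).
  have h1 : lp * Y <= (1 + sigma) * (1 + 2 * L2 * gamma0) * (lp * Y).
    rewrite ler_peMl ?mulr_ge0 ?(ltW lp_gt0)// mulr_ege1//; first lra.
    by rewrite lerDl !mulr_ge0.
  have h2 : 0 <= (1 + 2 * C) * gamma0 by rewrite mulr_ge0// addr_ge0// mulr_ge0.
  have h3 : 0 <= L2 * gamma0 ^+ 2 by rewrite mulr_ge0// sqr_ge0.
  by rewrite /Q; lra.
have Q0 : 0 < Q := lt_le_trans ap0 apQ.
have lmE : lm = (1 - sigma) * am * lp / Q by rewrite lm_def.
have amQ : 0 <= (1 - sigma) * am <= Q.
  rewrite mulr_ge0 ?(ltW s1') ?(ltW am_gt0)//=.
  apply: le_trans apQ; apply: le_trans (ltW am_lt_ap).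
  by rewrite ler_piMl ?(ltW am_gt0)//; lra.
have lm0 : 0 < lm by rewrite lmE divr_gt0// !mulr_gt0.
have lm_lp : lm <= lp.
  rewrite lmE mulrAC ler_piMl ?(ltW lp_gt0)// ler_pdivrMr// mul1r.
  by case/andP: amQ.
have [zp hzp] := resolvent_exists xp (T_max xp) lp_gt0.
have /andP[zp_ge zp_le] := newton_step_bounds H_maximal H_bounded P_maximal
  lp_gt0 s0' hzp ansp.
have zp_dist := resolvent_dist_zero G_monotone G_differentiable dG_lipschitz
  H_bounded P_approx lp_gt0 (lC _ (lexx _)) xs_zero hzp.
pose a := (1 + sigma) * am; pose b := (1 - sigma) * ap.
have a0 : 0 <= a by rewrite mulr_ge0 ?addr_ge0// ltW.
pose left (l : R) := forall z, resolvent (T (xt l)) l (xt l) z ->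
  l * enorm (z - xt l) <= a.
pose right (l : R) := forall z, resolvent (T (xt l)) l (xt l) z ->
  b <= l * enorm (z - xt l).
have to_left l y u e : lm <= l ->
    approx_newton_solution G P H sigma l (xt l) y u e ->
    l * enorm (y - xt l) < am -> left l.
  move=> lml ans small z hz; have l0 : 0 < l := lt_le_trans lm0 lml.
  have /andP[_ zle] := newton_step_bounds H_maximal H_bounded P_maximal
    l0 s0' hz ans.
  apply: (le_trans (ler_wpM2l (ltW l0) zle)).
  by rewrite mulrCA /a ler_wpM2l ?addr_ge0// ltW.
have to_right l y u e : lm <= l ->
    approx_newton_solution G P H sigma l (xt l) y u e ->
    ap < l * enorm (y - xt l) -> right l.
  move=> lml ans large z hz; have l0 : 0 < l := lt_le_trans lm0 lml.
  have /andP[zge _] := newton_step_bounds H_maximal H_bounded P_maximal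
    l0 s0' hz ans.
  apply: le_trans (ler_wpM2l (ltW l0) zge).
  by rewrite mulrCA /b ler_wpM2l ?(ltW s1')// ltW.
have right_lp : right lp.
  by rewrite xp_def in ansp; apply: (to_right _ _ _ _ lm_lp ansp); rewrite -xp_def.
have left_lm : left lm.
  move=> z hz; apply: (@le_trans _ _ ((1 - sigma) * am)); last first.
    by rewrite /a ler_wpM2r ?(ltW am_gt0)//; lra.
  have [w hw] := resolvent_exists xp (T_max xp) lm0.
  have [wzp _] := resolvent_monotone (T_max xp).1 lm0 lm_lp hw hzp.
  apply: le_trans (resolvent_change_base G_differentiable dG_lipschitz P_approx
    P_lipschitz P_maximal lm0 (lC _ lm_lp) hw hz) _.
  apply: (@left_endpoint_residual_le R L2 C gamma0 sigma am lp Y Q) => //.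
  - by rewrite mulr_ge0 ?enorm_ge0// ltW.
  - by rewrite -lmE ler_wpM2l ?(ltW lm0)// (le_trans wzp).
  - by rewrite mulr_ge0 ?enorm_ge0// ltW.
  - rewrite -lmE gamma0_def.
    rewrite (_ : lm / lp * _ = lm * (M1 * enorm (xp - xt 0))); last first.
      by field; rewrite gt_eqF.
    rewrite ler_wpM2l ?(ltW lm0)// xp_def.
    by have := xt_curve _ _ lm0 lm_lp; rewrite le_min => /andP[].
(* [C0 * lm / lp] is the numerator of [C0] over [Q * ((1 - C) * (1 - sigma))] *)
have lpC0 : lp <= C0 * lm.
  rewrite C0_def lmE.
  set N := (X in X / _ * _).
  have NQ : Q * ((1 - C) * (1 - sigma)) <= N.
    pose X := 2 * L' * lp ^+ 2 + lp * dp + lp ^+ 2 * L2 * dp ^+ 2.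
    have XY : lp * Y * ((1 - C) * (1 - sigma)) <= X.
      have h1 : (1 - C) * ((1 - sigma) * Y) <= (1 - C) * enorm (zp - xp).
        by rewrite ler_wpM2l// ltW.
      rewrite -dp_def in zp_dist.
      have := ler_wpM2l (ltW lp_gt0) (le_trans h1 zp_dist).
      have : 0 <= lp ^+ 2 * L2 * dp ^+ 2.
        exact: (mulr_ge0 (mulr_ge0 (sqr_ge0 lp) L20) (sqr_ge0 dp)).
      by rewrite /X; lra.
    have : (1 + sigma) * (1 + 2 * L2 * gamma0) * (lp * Y * ((1 - C) * (1 - sigma)))
        <= (1 + sigma) * (1 + 2 * L2 * gamma0) * X.
      by rewrite ler_wpM2l ?mulr_ge0 ?addr_ge0 ?mulr_ge0.
    by rewrite /N -/X /Q; lra.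
  rewrite (_ : N / _ * _ = N / (Q * ((1 - C) * (1 - sigma))) * lp); last first.
    by field; rewrite !gt_eqF.
  by rewrite ler_peMl ?(ltW lp_gt0)// ler_pdivlMr ?mul1r// !mulr_gt0.
pose K := C0 ^+ 2 * M0 * (1 + 2 * C + L2 * M0 * lp + 2 * (L2 + 1 / (M0 * lp)) * a).
have gap l m : lm <= l -> l <= m -> m <= lp -> left l -> right m ->
    b - a <= K * (m - l).
  move=> lml llm mlp hl hm; have l0 : 0 < l := lt_le_trans lm0 lml.
  have m0 : 0 < m := lt_le_trans l0 llm.
  have C00 : 0 <= C0 by rewrite -(pmulr_lge0 _ lm0) (le_trans _ lpC0)// ltW.
  apply: bracket_gap => //; first by rewrite (le_trans lpC0)// ler_wpM2l.
  have [z hz] := resolvent_exists (xt l) (T_max (xt l)) l0.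
  have [z' hz'] := resolvent_exists (xt m) (T_max (xt m)) m0.
  have Dm : l * enorm (xt l - xt m) <= M0 * (m - l).
    have := xt_curve _ _ l0 llm; rewrite le_min enormC => /andP[+ _].
    move/(ler_wpM2l (ltW l0)); congr (_ <= _).
    by field; rewrite gt_eqF.
  apply: le_trans (resolvent_growth G_differentiable dG_lipschitz P_approx
    P_lipschitz P_maximal L20 C0' l0 llm (lC _ (le_trans llm mlp)) hz hz'
    (hl _ hz) Dm).
  by rewrite ler_wpM2l ?sqr_ge0//; exact: hm.
have K0 : 0 <= K.
  have lp0 := ltW lp_gt0.
  have L2_inv : 0 <= L2 + 1 / (M0 * lp) by rewrite addr_ge0// divr_ge0// mulr_ge0.
  apply: mulr_ge0; first by rewrite mulr_ge0// sqr_ge0.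
  apply: addr_ge0; last by rewrite mulr_ge0// mulr_ge0.
  by rewrite addr_ge0 ?addr_ge0 ?mulr_ge0.
move=> n /(bisection_calls_le K0 to_left to_right gap).
move=> /(_ (lexx _) lm_lp (lexx _) left_lm right_lp) count.
have ba : 0 < b - a by rewrite subr_gt0 /a /b mulrC [ltRHS]mulrC.
set X := (X in log2 X).
have XE : X = K * lp / (b - a) by rewrite /X /K /b /a; ring.
have count' : (b - a) * 2 ^+ n <= 2 * K * lp.
  apply: (le_trans count); rewrite ler_wpM2l//.
    exact: mulr_ge0 (ler0n R 2) K0.
  by rewrite gerBl ltW.
have Klp : 0 < K * lp.
  have := lt_le_trans (mulr_gt0 ba (exprn_gt0 n (ltr0Sn R 1))) count'.
  by rewrite -mulrA pmulr_rgt0.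
have X0 : 0 < X by rewrite XE divr_gt0.
apply: (@le_log2_of_pow R n 2) => //.
rewrite XE mulrA ler_pdivlMr// mulrC; apply: (le_trans count').
by rewrite -mulrA ler_wpM2r// ?(ltW Klp)// expr2; lra.
Qed.
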